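(* Let $k\ge 1$ be an integer, let $G$ be a graph on $n$ vertices, and let $\Gamma$ be an abelian group with $|\Gamma|=(4k+2)n$ such that $\Gamma\cong \mathbb{Z}_{4k+2}\times \mathcal{A}$, where $\mathcal{A}$ is an abelian group with $|\mathcal{A}|=n$. Let $C_{4k+2}^{2k}$ denote the $2k$-th power of the cycle $C_{4k+2}$ on $4k+2$ vertices. (i) If the degrees of the vertices of $G$ are either all even or all odd, then $G\circ C_{4k+2}^{2k}$ is $\Gamma$-distance magic. (ii) If there exists a constant $m\in\mathbb{N}$ such that $\deg_G(u)\equiv m \pmod{4k+2}$ for all $u\in V(G)$, then $G\times C_{4k+2}^{2k}$ is $\Gamma$-distance magic.
   Context: All graphs are finite and simple; all groups are finite additive abelian groups. $N_G(u)$ is the set of vertices adjacent to $u$ in $G$, and $\deg_G(u)=|N_G(u)|$. For a graph $G$ and an abelian group $\Gamma$ with $|V(G)|=|\Gamma|$, a $\Gamma$-distance magic labeling of $G$ is a bijection $l:V(G)\to\Gamma$ for which there is an element $\mu_0\in\Gamma$ such that $w_G(u)=\sum_{v\in N_G(u)}l(v)=\mu_0$ for every $u\in V(G)$; $G$ is $\Gamma$-distance magic if it admits such a labeling. The lexicographic product $G\circ H$ and the direct product $G\times H$ both have vertex set $V(G)\times V(H)$; $(g,h)$ and $(g',h')$ are adjacent in $G\circ H$ iff $g$ is adjacent to $g'$ in $G$, or $g=g'$ and $h$ is adjacent to $h'$ in $H$; they are adjacent in $G\times H$ iff $g$ is adjacent to $g'$ in $G$ and $h$ is adjacent to $h'$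 in $H$. The $j$-th power $G^{j}$ of a graph $G$ has the same vertices as $G$, with two distinct vertices adjacent iff their distance in $G$ is at most $j$. *)

(* Defs.v *)
From HB Require Import structures.
From mathcomp Require Import all_boot all_order all_algebra.

Set Implicit Arguments.
Unset Strict Implicit.
Unset Printing Implicit Defensive.

Import GRing.Theory.

Local Open Scope nat_scope.

Record sgraph := SGraph {
  vertex :> finType;
  adj : rel vertex;
  adj_sym : symmetric adj;
  adj_irr : irreflexive adj
}.

Definition neighbors (G : sgraph) (u : G) : {set G} := [set v | adj u v].

Definition deg (G : sgraph) (u : G) : nat := #|neighbors u|.

Section LexProduct.
Variables G H : sgraph.

Definition lex_adj : rel (G * H) := fun p q =>
  adj p.1 q.1 || (p.1 == q.1) && adj p.2 q.2.

Fact lex_adj_sym : symmetric lex_adj.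
Proof. by move=> p q; rewrite /lex_adj adj_sym [adj p.2 _]adj_sym eq_sym. Qed.

Fact lex_adj_irr : irreflexive lex_adj.
Proof. by move=> p; rewrite /lex_adj !adj_irr andbF. Qed.

Definition lex_product : sgraph := SGraph lex_adj_sym lex_adj_irr.
End LexProduct.

Section DirectProduct.
Variables G H : sgraph.

Definition direct_adj : rel (G * H) := fun p q =>
  adj p.1 q.1 && adj p.2 q.2.

Fact direct_adj_sym : symmetric direct_adj.
Proof. by move=> p q; rewrite /direct_adj adj_sym [adj p.2 _]adj_sym. Qed.

Fact direct_adj_irr : irreflexive direct_adj.
Proof. by move=> p; rewrite /direct_adj adj_irr. Qed.

Definition direct_product : sgraph := SGraph direct_adj_sym direct_adj_irr.
End DirectProduct.

Section Power.
Variable G : sgraph.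

(* There is a walk with exactly d edges from u to v. *)
Definition walk (d : nat) (u v : G) : bool :=
  [exists p : d.-tuple G, path (@adj G) u p && (last u p == v)].

(* The least length of a walk from u to v, and None when u and v lie in       *)
(* different components. Lengths below #|G| suffice, see distP.               *)
Definition dist (u v : G) : option nat :=
  ohead [seq d <- iota 0 #|G| | walk d u v].

Lemma walkP d (u v : G) :
  reflect (exists p, [/\ size p = d, path (@adj G) u p & last u p = v])
          (walk d u v).
Proof.
apply: (iffP existsP) => [[p /andP[up /eqP lp]] | [p [sp up lp]]].
  by exists p; rewrite size_tuple.
have sp' : size p == d by apply/eqP.
by exists (Tuple sp'); rewrite /= up lp eqxx.
Qed.

Lemma walk_sym d : symmetric (walk d).
Proof.
suff W u v : walk d u v -> walk d v u by move=> u v; apply/idP/idP; apply: W.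
case/walkP=> p [sp up lp]; apply/walkP; exists (rev (belast u p)).
rewrite size_rev size_belast -lp; split=> //.
  by rewrite rev_path; apply: sub_path up => x y /=; rewrite adj_sym.
by case: (p) => //= x q; rewrite rev_cons last_rcons.
Qed.

Lemma walk_short d (u v : G) :
  walk d u v -> exists2 d', d' <= d & (d' < #|G|) && walk d' u v.
Proof.
case/walkP=> p [sp up lp]; move: lp; case/shortenP: up => q uq Uq sub_q lq.
exists (size q); first by rewrite -sp uniq_leq_size //; case/andP: Uq.
have -> /= : size q < #|G|.
  by have := max_card (mem (u :: q)); rewrite (card_uniqP Uq).
by apply/walkP; exists q.
Qed.

Lemma distP (u v : G) d :
  dist u v = Some d <-> walk d u v /\ (forall d', walk d' u v -> d <= d').
Proof.
have S : sorted ltn [seq i <- iota 0 #|G| | walk i u v].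
  by apply: sorted_filter (iota_ltn_sorted _ _); apply: ltn_trans.
have M i : (i \in [seq i <- iota 0 #|G| | walk i u v])
             = walk i u v && (i < #|G|).
  by rewrite mem_filter mem_iota.
rewrite /dist; case: [seq _ <- _ | _] S M => [|d0 s] /= S M.
  split=> // -[/walk_short[d' _ /andP[lt_d' wd']]] _.
  by have := M d'; rewrite wd' lt_d'.
have /andP[w0 lt0] : walk d0 u v && (d0 < #|G|) by rewrite -M mem_head.
have min0 d' : walk d' u v -> d0 <= d'.
  case/walk_short=> i le_i /andP[lt_i wi]; apply: leq_trans le_i.
  have : i \in d0 :: s by rewrite M wi.
  rewrite inE => /predU1P[-> // | s_i].
  by have /allP/(_ _ s_i)/ltnW := order_path_min ltn_trans S.
split=> [[<-] // | [wd min_d]]; congr Some.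
by apply/eqP; rewrite eqn_leq min0 ?min_d.
Qed.

Fact dist_sym (u v : G) : dist u v = dist v u.
Proof. by rewrite /dist; under eq_filter do rewrite walk_sym. Qed.

Variable j : nat.

Definition power_adj : rel G := fun u v =>
  (u != v) && (if dist u v is Some d then d <= j else false).

Fact power_adj_sym : symmetric power_adj.
Proof. by move=> u v; rewrite /power_adj eq_sym dist_sym. Qed.

Fact power_adj_irr : irreflexive power_adj.
Proof. by move=> u; rewrite /power_adj eqxx. Qed.

Definition power_graph : sgraph := SGraph power_adj_sym power_adj_irr.
End Power.

Section Cycle.
Variable m : nat.

(* ordS is the successor modulo m. The condition i != j only matters for      *)
(* m = 1; the graph is the cycle C_m when 3 <= m.                             *)
Definition cycle_adj : rel 'I_m := fun i j =>
  (i != j) && ((j == ordS i) || (i == ordS j)).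

Fact cycle_adj_sym : symmetric cycle_adj.
Proof. by move=> i j; rewrite /cycle_adj eq_sym orbC. Qed.

Fact cycle_adj_irr : irreflexive cycle_adj.
Proof. by move=> i; rewrite /cycle_adj eqxx. Qed.

Definition cycle_graph : sgraph := SGraph cycle_adj_sym cycle_adj_irr.
End Cycle.

Definition weight (G : sgraph) (Gamma : finZmodType) (l : G -> Gamma) (u : G)
  : Gamma := (\sum_(v in neighbors u) l v)%R.

Definition distance_magic_labeling (G : sgraph) (Gamma : finZmodType)
    (l : G -> Gamma) : Prop :=
  bijective l /\ exists mu0 : Gamma, forall u : G, weight l u = mu0.

Definition distance_magic (G : sgraph) (Gamma : finZmodType) : Prop :=
  exists l : G -> Gamma, distance_magic_labeling l.

Definition zmod_isomorphic (A B : zmodType) : Prop :=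
  exists f : {additive A -> B}, bijective f.

(* Main.v *)
Require Import Defs.
From HB Require Import structures.
From mathcomp Require Import all_boot all_order all_algebra.
From mathcomp Require Import zify.

(** In the cycle on 2h vertices, the only vertex at distance larger than h - 1
from i is its antipode, so the (h - 1)-th power of this cycle is a complete
graph minus a perfect matching. Take c = (1, 0) in Z_2h x A. As 1 is not the
double of an element of Z_2h, the involution z |-> c - z has no fixed point, and
one can label each pair of antipodes in each copy of the cycle by an orbit
{z, c - z}. The labels of a copy then add up to h c, and the labels of the
neighbors within a copy to h c - c. So the weight at (u, i) is
deg(u) h c + h c - c in the lexicographic product and deg(u) (h c - c) in the
direct product, where 2h c = 0. *)

Set Implicit Arguments.
Unset Strict Implicit.
Unset Printing Implicit Defensive.

Import GRing.Theory.

(** Any walk of length at most [j] bounds the distance, so adjacency can be shown without exhibiting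
    a shortest walk. *)
Lemma power_adjP (G : sgraph) j (u v : G) :
  reflect (u != v /\ exists2 d, d <= j & walk d u v) (power_adj j u v).
Proof.
rewrite /power_adj; apply: (iffP andP) => [[neq_uv]|[neq_uv [d le_dj wd]]].
  by case E: (dist u v) => [d|//] le_dj; split=> //; exists d; case/distP: E.
split=> //; have [d0 wd0 min_d0] := ex_minnP (ex_intro (fun d => walk d u v) d wd).
have /distP-> : walk d0 u v /\ (forall d', walk d' u v -> d0 <= d') by [].
exact: leq_trans (min_d0 d wd) le_dj.
Qed.

Lemma val_ordS N (i : 'I_N) :
  (i.+1 < N /\ ordS i = i.+1 :> nat) \/ (i.+1 = N /\ ordS i = 0 :> nat).
Proof.
have := ltn_ord i; rewrite leq_eqVlt => /predU1P[E|lt_iN]; [right|left].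
  by rewrite /= E modnn.
by rewrite /= modn_small.
Qed.

Lemma val_iter_ordS N d (i : 'I_N) : iter d (@ordS N) i = (i + d) %% N :> nat.
Proof.
elim: d => [|d IHd] /=; first by rewrite addn0 modn_small.
by rewrite IHd addnS -addn1 modnDml addn1.
Qed.

Lemma cycle_walk_iter N d (u : cycle_graph N) :
  1 < N -> walk d u (iter d (@ordS N) u).
Proof.
move=> N_gt1; apply/walkP; exists (traject (@ordS N) (ordS u) d).
rewrite size_traject; split=> //; last exact: last_traject.
apply: sub_path (fpath_traject _ _ _) => i j /= /eqP <-.
rewrite /cycle_adj eqxx andbT; apply/eqP => /(congr1 (@nat_of_ord N)).
by case: (val_ordS i); lia.
Qed.

(** Each edge changes the index by one or jumps between [0] and [N - 1]. The outer disjuncts bound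
    [d] from below by the length of one or the other arc between [u] and [v]. *)
Lemma cycle_walk_bound N d (u v : cycle_graph N) : walk d u v ->
  ((u : 'I_N) <= (v : 'I_N) + d /\ (v : 'I_N) <= (u : 'I_N) + d) \/
  (N + (u : 'I_N) <= (v : 'I_N) + d \/ N + (v : 'I_N) <= (u : 'I_N) + d).
Proof.
case/walkP=> p []; elim: p d u => [|w p IHp] [|d] u //=.
  by move=> _ _ ->; lia.
case=> sz_p /andP[/andP[_ uw] wp] lp; have := IHp d w sz_p wp lp.
have ltu := ltn_ord (u : 'I_N); have ltw := ltn_ord (w : 'I_N).
have ltv := ltn_ord (v : 'I_N).
case/orP: uw => /eqP E.
  by have := val_ordS (u : 'I_N); rewrite -E; lia.
by have := val_ordS (w : 'I_N); rewrite -E; lia.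
Qed.

Section Antipode.
Variable h : nat.
Implicit Types i j : 'I_(h + h).

Definition antipode i : 'I_(h + h) := iter h (@ordS (h + h)) i.

Lemma val_antipode i :
  (i < h /\ antipode i = i + h :> nat) \/ (h <= i /\ i = antipode i + h :> nat).
Proof.
have lti := ltn_ord i; rewrite val_iter_ordS; case: (ltnP i h) => [ltih|leih].
  by left; rewrite modn_small //; lia.
right; split=> //; have -> : i + h = h + h + (i - h) by lia.
by rewrite modnDl modn_small; lia.
Qed.

Lemma antipodeK : involutive antipode.
Proof.
move=> i; apply: val_inj => /=; have lti := ltn_ord i.
by case: (val_antipode i) (val_antipode (antipode i)); lia.
Qed.

Lemma antipode_neq i : 0 < h -> antipode i != i.
Proof.
move=> h_gt0; apply/eqP => /(congr1 (@nat_of_ord _)).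
by case: (val_antipode i); lia.
Qed.

Lemma cycle_power_adj i j : 1 < h ->
  @power_adj (cycle_graph (h + h)) h.-1 i j = (i != j) && (j != antipode i).
Proof.
move=> h_gt1; have lti := ltn_ord i; have ltj := ltn_ord j.
have walk_mod (u v : 'I_(h + h)) d : u + d = v \/ u + d = h + h + v ->
    @walk (cycle_graph (h + h)) d u v.
  move=> E; suff -> : v = iter d (@ordS (h + h)) u.
    by apply: cycle_walk_iter; lia.
  apply: val_inj; rewrite /= val_iter_ordS.
  by case: E => ->; rewrite ?modnDl modn_small.
apply/power_adjP/andP => -[neq_ij H]; split=> //.
  (* Both arcs between [i] and its antipode have length [h], which exceeds [h.-1]. *)
  apply/eqP => /(congr1 (@nat_of_ord _)) Ej.
  case: H => d led /cycle_walk_bound.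
  by case: (val_antipode i); lia.
have neq_val : i <> j :> nat by move=> /val_inj /eqP; apply/negP.
have neq_ant : j <> antipode i :> nat by move=> /val_inj /eqP; apply/negP.
(* The gap between the two indices is not [h]. If smaller, it is the length of a walk that does not
   wrap; if larger, the walk passes through [0] and has length [h + h] minus the gap. *)
have [le1|lt1] := leqP j (i + h.-1); last first.
  exists (i + (h + h) - j); last by rewrite walk_sym walk_mod //; lia.
  by case: (val_antipode i); lia.
have [le2|lt2] := leqP i j.
  by exists (j - i); [lia | apply: walk_mod; lia].
have [le3|lt3] := leqP i (j + h.-1).
  by exists (i - j); [lia | rewrite walk_sym walk_mod //; lia].
exists (j + (h + h) - i); last by apply: walk_mod; lia.
by case: (val_antipode i); lia.
Qed.

Variables (V : zmodType) (c : V) (f : 'I_(h + h) -> V).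
Hypothesis f_antipode : forall i, (f i + f (antipode i) = c)%R.

Lemma sum_antipodal : (\sum_i f i = c *+ h)%R.
Proof.
(* Cutting the index range at [h] pairs each [i < h] with its antipode [i + h]. *)
rewrite big_split_ord /= -big_split /= (eq_bigr (fun=> c)).
  by rewrite sumr_const card_ord.
move=> i _; rewrite -(f_antipode (lshift h i)); congr (_ + f _)%R.
apply: val_inj => /=; have := ltn_ord i.
by case: (val_antipode (lshift h i)) => /=; lia.
Qed.

End Antipode.

Lemma weight_cycle_power h (Gamma : finZmodType) (c : Gamma)
    (f : power_graph (cycle_graph (h + h)) h.-1 -> Gamma) i :
  1 < h -> (forall j, (f j + f (antipode j) = c)%R) ->
  weight f i = (c *+ h - c)%R.
Proof.
move=> h_gt1 fc; rewrite -(sum_antipodal fc) (bigD1 i) //= (bigD1 (antipode i)) /=.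
  rewrite addrA fc [RHS]addrC addKr.
  apply: eq_bigl => j; rewrite inE /=.
  by rewrite [LHS]cycle_power_adj // eq_sym.
by rewrite antipode_neq //; lia.
Qed.

Lemma weight_lex_product (G H : sgraph) (Gamma : finZmodType)
    (l : lex_product G H -> Gamma) u i :
  weight l (u, i) =
  (\sum_(v in neighbors u) \sum_j l (v, j) + weight (fun j => l (u, j)) i)%R.
Proof.
rewrite /weight (bigID (fun p => adj u p.1)) /=; congr (_ + _)%R.
  rewrite pair_big_dep; apply: eq_big => -[v j] //=.
  by rewrite !inE /= /lex_adj /=; case: (adj u v); rewrite ?andbF.
(* Only the copy of [u] remains; as [adj] is irreflexive, it took no part in the first sum. *)
transitivity (\sum_(v | v == u) \sum_(j in neighbors i) l (v, j))%R; last first.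
  by rewrite big_pred1_eq.
rewrite pair_big_dep; apply: eq_big => -[v j] //=.
rewrite !inE /= /lex_adj /= [v == u]eq_sym; case: eqP => [->|_].
  by rewrite adj_irr andbT.
by rewrite orbF andbN.
Qed.

Lemma weight_direct_product (G H : sgraph) (Gamma : finZmodType)
    (l : direct_product G H -> Gamma) u i :
  weight l (u, i) =
  (\sum_(v in neighbors u) weight (fun j => l (v, j)) i)%R.
Proof.
by rewrite /weight pair_big_dep; apply: eq_big => -[v j] //=; rewrite !inE.
Qed.

(** Lets a degree be replaced by its residue: modulo 2 for the lexicographic product, modulo [h + h]
    for the direct one. *)
Lemma mulrn_eq_mod (V : zmodType) (x : V) N a b :
  (x *+ N = 0)%R -> a = b %[mod N] -> (x *+ a = x *+ b)%R.
Proof.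
move=> xN0 eq_ab; rewrite (divn_eq a N) (divn_eq b N) eq_ab.
by rewrite !mulrnDr ![_ * N]mulnC !mulrnA xN0 !mul0rn.
Qed.

(** The first coordinate depends on [i] alone and determines it. The second is [phi u] on one half
    of the cycle and its negative on the other, so it cancels over antipodes and, once [i] is known,
    determines [u]. *)
Lemma antipodal_labeling h (T : finType) (A : finZmodType) :
  0 < h -> #|T| = #|A| ->
  exists l : T * 'I_(h + h) -> 'Z_(h + h) * A,
    bijective l /\
    forall u i, (l (u, i) + l (u, antipode i) = (1, 0))%R.
Proof.
move=> h_gt0 cardT.
have Zh : (Zp_trunc (h + h)).+2 = h + h by apply: Zp_cast; lia.
pose phi (u : T) : A := enum_val (cast_ord cardT (enum_rank u)).
have phi_inj : injective phi.
  by move=> u v /enum_val_inj /cast_ord_inj /enum_rank_inj.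
(* t maps 0, ..., 2h - 1 onto 1, ..., 2h, and for i < h, t i + t (i + h) = 2h + 1. *)
pose t (i : nat) := if i < h then i.+1 else 3 * h - i.
have t_inj (i j : 'I_(h + h)) : ((t i)%:R = (t j)%:R :> 'Z_(h + h))%R -> i = j.
  have lti := ltn_ord i; have ltj := ltn_ord j.
  move=> /(congr1 (@nat_of_ord _)); rewrite !val_Zp_nat; try by lia.
  (* Among the values of [t], only [t h = h + h] is changed by reduction; it becomes 0, which no
     other index attains. *)
  have t_mod x : x < h + h ->
      t x %% (h + h) = if x == h then 0 else t x.
    move=> ltx; case: eqP => [->|neq_xh].
      have -> : t h = h + h by rewrite /t ltnn; lia.
      exact: modnn.
    by rewrite modn_small // /t; case: (ltnP x h); lia.
  rewrite !t_mod // => E; apply: val_inj => /=; move: E; rewrite /t.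
  by do 2!case: eqP => ?; case: (ltnP i h) => ?; case: (ltnP j h); lia.
pose l (p : T * 'I_(h + h)) : 'Z_(h + h) * A :=
  (((t p.2)%:R)%R, if p.2 < h then phi p.1 else (- phi p.1)%R).
exists l; split=> [|u i].
  apply: inj_card_bij => [[u i] [v j] [/t_inj <-]|].
    by case: ifP => _ => [|/oppr_inj] /phi_inj ->.
  by rewrite !card_prod !card_ord cardT Zh mulnC.
wlog lt_ih : i / i < h.
  case: (ltnP i h) => [lt_ih|le_hi] W; first exact: W.
  rewrite addrC -{2}(antipodeK i); apply: W; have := ltn_ord i.
  by case: (val_antipode i); lia.
rewrite /l /t /= lt_ih; case: (val_antipode i) => -[]; last by lia.
move=> _ ->; rewrite ltnNge leq_addl /=; congr pair; last exact: subrr.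
rewrite -natrD; have -> : i.+1 + (3 * h - (i + h)) = h + h + 1 by lia.
by rewrite natrD char_Zp ?add0r //; lia.
Qed.

Theorem theorem3p1 (k n : nat) (G : sgraph) (Gamma A : finZmodType)
    (hk : 1 <= k)
    (hG : #|G| = n)
    (hGamma : #|Gamma| = (4 * k + 2) * n)
    (hA : #|A| = n)
    (hiso : zmod_isomorphic Gamma ('Z_(4 * k + 2) * A)%type) :
  ((forall u : G, ~~ odd (deg u)) \/ (forall u : G, odd (deg u)) ->
     distance_magic
       (lex_product G (power_graph (cycle_graph (4 * k + 2)) (2 * k))) Gamma)
  /\
  ((exists m : nat, forall u : G, deg u = m %[mod 4 * k + 2]) ->
     distance_magic
       (direct_product G (power_graph (cycle_graph (4 * k + 2)) (2 * k))) Gamma).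
Proof.
move: hiso; pose h := (2 * k).+1; have h_gt1 : 1 < h by rewrite /h; lia.
have -> : 4 * k + 2 = h + h by rewrite /h; lia.
have -> : 2 * k = h.-1 by [].
case=> f f_bij; have f_inj := bij_inj f_bij; have [g fK gK] := f_bij.
have [|l [l_bij lC]] := @antipodal_labeling h G A (ltnW h_gt1).
  by rewrite hG hA.
(* Additivity is given for [f], not for its inverse [g], so the identities for [l'] and [c] are
   checked after applying [f]. *)
pose c := g (1, 0)%R; pose l' p := g (l p).
have l'_bij : bijective l' by apply: bij_comp l_bij; exists f.
have l'C u i : (l' (u, i) + l' (u, antipode i) = c)%R.
  by apply: f_inj; rewrite raddfD /= !gK lC.
have cN0 : (c *+ (h + h) = 0)%R.
  apply: f_inj; rewrite raddfMn raddf0 gK.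
  have pairMn (x : 'Z_(h + h)) (y : A) e :
      ((x, y) *+ e = (x *+ e, y *+ e) :> 'Z_(h + h) * A)%R.
    by elim: e => // e IHe; rewrite !mulrS IHe.
  by rewrite pairMn mul0rn char_Zp //; lia.
have c_even : ((c *+ h) *+ 2 = 0)%R by rewrite mulr2n -mulrnDr.
split=> [parity|[m deg_m]]; exists l'; split=> //.
  have [b odd_deg] : exists b : bool, forall u : G, odd (deg u) = b.
    by case: parity => E; [exists false => u; apply/negbTE | exists true].
  (* Each neighboring copy contributes [c *+ h], whose double is 0, so the degree enters only
     through the common parity [b], read as 0 or 1. *)
  exists ((c *+ h) *+ b + (c *+ h - c))%R => -[u i].
  rewrite weight_lex_product (weight_cycle_power (c := c)) //; congr (_ + _)%R.
  rewrite (eq_bigr (fun=> c *+ h)%R) => [|v _]; last exact: sum_antipodal.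
  rewrite sumr_const; apply: mulrn_eq_mod c_even _.
  by rewrite !modn2 odd_deg oddb.
exists ((c *+ h - c) *+ m)%R => -[u i].
rewrite weight_direct_product (eq_bigr (fun=> c *+ h - c)%R) => [|v _].
  rewrite sumr_const; apply: (mulrn_eq_mod (N := h + h)); last first.
    by rewrite [LHS]deg_m.
  by rewrite mulrnBl -mulrnA mulnC mulrnA cN0 mul0rn subr0.
exact: weight_cycle_power.
Qed.
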